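(* Let $P_i=D_i.A_i$ ($1\le i\le n$) and $P=D.A$ be tccp processes (not necessarily closed), let $\phi_1,\dots,\phi_n,\phi$ be temporal formulas, and let $e$ be an environment. If the correctness assertion $P\;\mathit{sat}\;\phi$ is derivable in the proof system TL from the assumptions $P_1\;\mathit{sat}\;\phi_1,\dots,P_n\;\mathit{sat}\;\phi_n$, and $\models_e P_i\;\mathit{sat}\;\phi_i$ for every $i=1,\dots,n$, then $\models_e P\;\mathit{sat}\;\phi$.
   Context: Constraint system: a cylindric constraint system $\mathcal C$: a complete algebraic lattice with lub $\sqcup$, least element $\mathit{true}$, greatest $\mathit{false}$, entailment $c\vdash d$ iff $d\le c$, cylindrifications $\exists_x$ (for $x$ in a denumerable set of variables) satisfying $c\vdash\exists_x c$, monotonicity, $\exists_x(c\sqcup\exists_x d)=\exists_x c\sqcup\exists_x d$, $\exists_x\exists_y c=\exists_y\exists_x c$, and diagonal elements $d_{xy}$ with the usual axioms ($\mathit{true}\vdash d_{xx}$; $d_{xy}=\exists_z(d_{xz}\sqcup d_{zy})$ for $z\ne x,y$; $d_{xy}\sqcup\exists_x(c\sqcup d_{xy})\vdash c$ for $x\neq y$). Finite constraints are the compact elements; $\exists_x$ of a finite constraint is assumed finite. tccp agents: $A::=\mathbf{tell}(c)\mid\sum_{i=1}^n\mathbf{ask}(c_i)\to A_i\mid\mathbf{now}\ c\ \mathbf{then}\ A\ \mathbf{else}\ B\mid A\parallel B\mid\exists xA\mid p(x)$ with finite $c,c_i$. A process $D.A$ has a set $D$ of declarations $p(x)::A$; recursion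 is guarded (every call is within an $\mathbf{ask}$), and $D$ is closed under parameter names: if $p(x)::A\in D$ and $p(y)$ occurs, then $p(y)::\exists x(\mathbf{tell}(d_{xy})\parallel A)\in D$. $\mathbf{tell}(c)\to A$ abbreviates $\mathbf{tell}(c)\parallel(\mathbf{ask}(\mathit{true})\to A)$. Reactive sequences: finite sequences $\langle c_1,d_1\rangle\cdots\langle c_{n-1},d_{n-1}\rangle\langle c_n,c_n\rangle$ ($n\ge1$) of finite constraints with $d_i\vdash c_i$ and $c_j\vdash d_{j-1}$; $\mathcal S$ is their set, $\cdot$ concatenation. Denotational semantics with environments: an environment is $e:\mathit{Pvar}\to\wp(\mathcal S)$. Semantic operators on sets of reactive sequences: (choice) $\tilde\sum_{i=1}^n c_i\to S_i$ is the set of $s\cdot s'\in\mathcal S$ with $s=\langle d_1,d_1\rangle\cdots\langle d_m,d_m\rangle$, $d_j\not\vdash c_i$ for all $j<m$ and all $i$, $d_m\vdash c_h$ and $s'\in S_h$ for some $h$, together with all $s=\langle d_1,d_1\rangle\cdots\langle d_m,d_m\rangle\in\mathcal S$ with $d_j\not\vdash c_i$ for all $j\le m$, all $i$. (parallel) $\langle c_1,d_1\rangle\cdots\langle c_n,d_n\rangle\langle d,d\rangle\tilde\parallel\langle c_1,e_1\rangle\cdots\langle c_n,e_n\rangle\langle d,d\rangle=\langle c_1,d_1\sqcup e_1\rangle\cdots\langle c_n,d_n\sqcup e_n\rangle\langle d,d\rangle$ (undefined otherwise), extended pointwise to sets. (now) $\tilde{now}(c,S_1,S_2)=\{s=\langle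 c',d\rangle\cdot s'\in\mathcal S\mid (c'\vdash c\wedge s\in S_1)\vee(c'\not\vdash c\wedge s\in S_2)\}$. (hiding) For $s=\langle c_1,d_1\rangle\cdots$, $\exists_x s$ applies $\exists_x$ to every component; $s'=\langle c_1,d_1\rangle\cdots\langle c_n,c_n\rangle$ is $x$-connected if $\exists_x c_1=c_1$ and $\exists_x c_i\sqcup d_{i-1}=c_i$ for $i\in[2,n]$; $s$ is $x$-invariant if every pair $\langle c,d\rangle$ of $s$ satisfies $d=\exists_x d\sqcup c$; $\tilde\exists xS=\{s\in\mathcal S\mid\exists s'\in S:\ \exists_x s=\exists_x s',\ s'\ x\text{-connected},\ s\ x\text{-invariant}\}$. Then $[\![D.\mathbf{stop}]\!](e)=\{\langle c_1,c_1\rangle\cdots\langle c_n,c_n\rangle\in\mathcal S\mid n\ge1\}$; $[\![D.\mathbf{tell}(c)]\!](e)=\{\langle d,d\sqcup c\rangle\cdot s\in\mathcal S\mid s\in[\![D.\mathbf{stop}]\!](e)\}$; $[\![D.\sum\mathbf{ask}(c_i)\to A_i]\!](e)=\tilde\sum c_i\to[\![D.A_i]\!](e)$; $[\![D.\mathbf{now}\ c\ \mathbf{then}\ A\ \mathbf{else}\ B]\!](e)=\tilde{now}(c,[\![D.A]\!](e),[\![D.B]\!](e))$; $[\![D.A\parallel B]\!](e)=[\![D.A]\!](e)\tilde\parallel[\![D.B]\!](e)$; $[\![D.\exists xA]\!](e)=\tilde\exists x[\![D.A]\!](e)$; $[\![D.p(x)]\!](e)=\mu\Psi$ (least fixpoint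 w.r.t. inclusion) with $\Psi(f)=[\![D\setminus\{p\}.A]\!](e\{f/p\})$ where $p(x)::A\in D$; for $p\notin D$, $[\![D.p(x)]\!](e)=e(p)$. Temporal logic: predicate variables $M\ni X,Y$ with distinguished $I,O$; formulas $\phi::=p\le q\mid X(c)\mid\neg\phi\mid\phi\wedge\psi\mid\exists V\phi\mid\bigcirc\phi\mid\phi\,\mathcal U\,\psi$ with $V$ a constraint-system variable, a constraint variable $p$, or a predicate variable; abbreviations $c=d$, $\Diamond\phi=\mathit{true}\,\mathcal U\,\phi$, $\Box\phi=\neg\Diamond\neg\phi$, $\vee,\to,\leftrightarrow$. Predicate assignments $v:M\to\mathcal C$ with $v(O)\vdash v(I)$; sequences $\rho=v_1,\dots,v_n$ monotonic ($v_{i+1}(X)\vdash v_i(X)$, $v_{i+1}(I)\vdash v_i(O)$). Truth $\rho\models_\gamma\phi$ for constraint assignment $\gamma$: $p\le q$ iff $\gamma(q)\vdash\gamma(p)$; $X(c)$ iff $v_1(X)\vdash c$; Boolean connectives standard; $\exists x\phi$ (resp. $\exists X\phi$) iff some $\rho'$ with $\exists x\rho=\exists x\rho'$ (pointwise applying $\exists_x$ to all values; resp. agreeing except on $X$) satisfies $\phi$; $\exists p\phi$ iff $\phi$ holds under $\gamma\{c/p\}$ for some $c$; $\bigcirc\phi$ iff $\bigcirc\rho\models_\gamma\phi$ where $\bigcirc v_1=v_1$ and $\bigcirc(v_1\cdots v_n)=v_2\cdots v_n$ for $n>1$; $\phi\,\mathcal U\,\psi$ iff some suffix $\rho'$ of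 $\rho$ (possibly $\rho$) satisfies $\psi$ and every suffix strictly longer than $\rho'$ (up to $\rho$) satisfies $\phi$. $\rho\models\phi$ iff for all $\gamma$; $\models\phi$ iff for all $\rho$. Assertions: $\models_e D.A\;\mathit{sat}\;\phi$ iff $\rho\models\phi$ for all $\rho=v_1,\dots,v_n$ with $\langle v_1(I),v_1(O)\rangle\cdots\langle v_n(I),v_n(O)\rangle\in[\![D.A]\!](e)$. Proof system TL (with $\mathit{stut}:=\forall p(O(p)\leftrightarrow I(p))$, $I_i:=I(c_i)$): T1 $\mathbf{tell}(c)\;\mathit{sat}\;O(c)\wedge\forall p(O(p)\to\exists q(I(q)\wedge q\sqcup c=p))\wedge\bigcirc\Box\mathit{stut}$. T2 from $A_i\;\mathit{sat}\;\phi_i$ ($i\in[1,n]$) infer $\sum_{i=1}^n\mathbf{ask}(c_i)\to A_i\;\mathit{sat}\;\bigvee_{i=1}^n((\bigwedge_j\neg I_j\wedge\mathit{stut})\,\mathcal U\,(I_i\wedge\mathit{stut}\wedge\bigcirc\phi_i))\vee\Box(\bigwedge_j\neg I_j\wedge\mathit{stut})$. T3 from $A\;\mathit{sat}\;\phi$, $B\;\mathit{sat}\;\psi$ infer $\mathbf{now}\ c\ \mathbf{then}\ A\ \mathbf{else}\ B\;\mathit{sat}\;(I(c)\wedge\phi)\vee(\neg I(c)\wedge\psi)$. T4 from $A\;\mathit{sat}\;\phi$ infer $\exists xA\;\mathit{sat}\;\exists x(\phi\wedge\mathit{loc}(x))\wedge\mathit{inv}(x)$, with $\mathit{loc}(x)=\forall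 p(\exists_x p\ne p\to(\neg I(p)\wedge\Box(\bigcirc I(p)\to\exists r(O(r)\wedge\exists_x p\sqcup r=p))))$ and $\mathit{inv}(x)=\forall p\Box(\exists_x p\ne p\to(O(p)\to\exists r(I(r)\wedge\exists_x p\sqcup r=p)))$. T5 from $A\;\mathit{sat}\;\phi$, $B\;\mathit{sat}\;\psi$ infer $A\parallel B\;\mathit{sat}\;\exists X,Y(\phi[X/O]\wedge\psi[Y/O]\wedge\mathit{par}(X,Y))$ for distinct $X,Y\notin FV(\phi)\cup FV(\psi)$, where $\mathit{par}(X,Y)=\forall p\Box(O(p)\leftrightarrow\exists q_1,q_2(X(q_1)\wedge Y(q_2)\wedge q_1\sqcup q_2=p))$. T6 (recursion) if $D\setminus\{p\}.A\;\mathit{sat}\;\phi$ is derivable from the assumption $D\setminus\{p\}.p(x)\;\mathit{sat}\;\phi$, where $p(x)::A\in D$, infer $D.p(x)\;\mathit{sat}\;\phi$. T7 from $A\;\mathit{sat}\;\phi$ and $\models\phi\to\psi$ infer $A\;\mathit{sat}\;\psi$. (Declarations are implicit in T1–T5, T7.)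
   Formalization: X(p), for a constraint variable p, is read as ''the value of X is p'', not as entailment; and the sequences ρ' in the clauses for ∃x, ∃X need only be monotone in each predicate variable, without the conditions relating I and O. With the literal clauses rules T1 and T5 are unsound. *)

(* Defs.v *)
From HB Require Import structures.
From Stdlib Require Export List Sorted.
From mathcomp Require Export all_boot all_order finmap.
From mathcomp Require Export boolp classical_sets.

Set Implicit Arguments.
Unset Strict Implicit.
Unset Printing Implicit Defensive.

Import Order.TTheory.

Local Open Scope classical_set_scope.
Local Open Scope order_scope.

Definition directed d (C : porderType d) (A : set C) : Prop :=
  A !=set0 /\
  forall a b, A a -> A b -> exists2 c, A c & (a <= c) && (b <= c).

(* The finite constraints are the compact elements. *)
Definition finite_constraint d (C : porderType d) (c : C) : Prop :=
  forall A u, directed A -> supremums A u -> c <= u -> exists2 a, A a & c <= a.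

(* Constraint-system variables are natural numbers.  Entailment is the
   converse of the order: [c] entails [d] is [d <= c]; hence [\bot] is true,
   [\top] is false, and the lub of two constraints is [`|`]. *)
Notation csvar := nat (only parsing).

HB.mixin Record isCylindric (d : Order.disp_t) C of Order.TBLattice d C := {
  cyl : csvar -> C -> C;
  diag : csvar -> csvar -> C;
  complete : forall A : set C, supremums A !=set0;
  algebraic : forall c : C,
    supremums [set k | finite_constraint k /\ k <= c] c;
  cyl_le : forall x c, cyl x c <= c;
  cyl_mono : forall x c c', c <= c' -> cyl x c <= cyl x c';
  cyl_join : forall x c c', cyl x (c `|` cyl x c') = cyl x c `|` cyl x c';
  cylC : forall x y c, cyl x (cyl y c) = cyl y (cyl x c);
  cyl_finite : forall x c, finite_constraint c -> finite_constraint (cyl x c);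
  diag_refl : forall x, diag x x <= \bot;
  diag_trans : forall x y z, z != x -> z != y ->
    diag x y = cyl z (diag x z `|` diag z y);
  diag_subst : forall x y c, x != y ->
    c <= diag x y `|` cyl x (c `|` diag x y);
}.

#[short(type="cylindricType")]
HB.structure Definition Cylindric d :=
  { C of isCylindric d C & Order.TBLattice d C }.

Notation "c ⊢ d" := (d <= c) (at level 70, no associativity) : order_scope.

Notation pvar := nat (only parsing).
Notation cvar := nat (only parsing).

Section Tccp.
Context {disp : Order.disp_t} {C : cylindricType disp}.
Implicit Types (c : C) (x y : csvar) (p q : pvar).

Inductive agent : Type :=
  | Tell of C
  | Ask (n : nat) of ('I_n -> C) & ('I_n -> agent)
  | Now of C & agent & agent
  | Par of agent & agent
  | Hide of csvar & agent
  | Call of pvar & csvar.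

(* The empty choice is the inactive agent, see [den_stop]. *)
Definition stop : agent := Ask (fun _ : 'I_0 => \bot) (fun _ => Tell \bot).

(* [D.[? p] = Some (x, A)] represents p(x) :: A together with its variants
   p(y) :: Hide x (tell(d_xy) || A) for all the other parameters y, so that
   every [D] is closed under parameter names. *)
Definition decls : Type := {fmap pvar -> csvar * agent}.

Definition variant x A y : agent :=
  if y == x then A else Hide x (Par (Tell (diag x y)) A).

Definition decl_body (D : decls) p y : option agent :=
  omap (fun xA => variant xA.1 xA.2 y) D.[? p]%fmap.

Fixpoint finite_agent (A : agent) : Prop :=
  match A with
  | Tell c => finite_constraint c
  | Ask n cs As =>
      (forall i, finite_constraint (cs i)) /\ (forall i, finite_agent (As i))
  | Now c A B => [/\ finite_constraint c, finite_agent A & finite_agent B]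
  | Par A B => finite_agent A /\ finite_agent B
  | Hide _ A => finite_agent A
  | Call _ _ => True
  end.

Fixpoint guarded (A : agent) : bool :=
  match A with
  | Tell _ | Ask _ _ _ => true
  | Now _ A B | Par A B => guarded A && guarded B
  | Hide _ A => guarded A
  | Call _ _ => false
  end.

Fixpoint calls p y (A : agent) : bool :=
  match A with
  | Tell _ => false
  | Ask n _ As => [exists i, calls p y (As i)]
  | Now _ A B | Par A B => calls p y A || calls p y B
  | Hide _ A => calls p y A
  | Call q z => (q == p) && (z == y)
  end.

Definition occurs_call p y (D : decls) (A : agent) : Prop :=
  calls p y A \/
  exists q x B, D.[? q]%fmap = Some (x, B) /\ calls p y B.

Definition free_pvar p (D : decls) (A : agent) : Prop :=
  p \notin D /\ exists y, occurs_call p y D A.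

(* The last clause says that the variants of declarations which are called
   are themselves agents. *)
Definition process (D : decls) (A : agent) : Prop :=
  finite_agent A /\
  forall p x B, D.[? p]%fmap = Some (x, B) ->
    [/\ finite_agent B, guarded B
      & forall y, occurs_call p y D A -> y != x ->
          finite_constraint (diag x y : C)].

Definition reactive (s : seq (C * C)) : Prop :=
  [/\ s != [::],
      {in s, forall u, finite_constraint u.1 /\ finite_constraint u.2},
      all (fun u => u.2 ⊢ u.1) s,
      sorted (fun u u' => u'.1 ⊢ u.2) s
    & (last (\bot, \bot) s).1 = (last (\bot, \bot) s).2].

Record rseq : Type := RSeq { rval :> seq (C * C); rvalP : reactive rval }.

Definition env : Type := pvar -> set rseq.

Definition stop_sem : set rseq := [set s | {in rval s, forall u, u.1 = u.2}].

Definition tell_sem c : set rseq :=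
  [set s | exists d (s' : rseq),
     stop_sem s' /\ rval s = (d, d `|` c) :: rval s'].

Definition choice_sem n (cs : 'I_n -> C) (S : 'I_n -> set rseq) : set rseq :=
  ([set s | exists (ds : seq C) (dm : C) (h : 'I_n) (s' : rseq),
     [/\ rval s = [seq (d, d) | d <- rcons ds dm] ++ rval s',
         {in ds, forall d, forall i, ~ (d ⊢ cs i)},
         dm ⊢ cs h
       & S h s']]
  `|`
  [set s | exists ds : seq C,
     rval s = [seq (d, d) | d <- ds] /\
     {in ds, forall d, forall i, ~ (d ⊢ cs i)}])%classic.

(* The parallel composition of [s1] and [s2] is defined and equals [s]. *)
Definition par_seq (s1 s2 s : seq (C * C)) : Prop :=
  exists (t : seq (C * (C * C))) (d : C),
    [/\ s1 = rcons [seq (u.1, u.2.1) | u <- t] (d, d),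
        s2 = rcons [seq (u.1, u.2.2) | u <- t] (d, d)
      & s = rcons [seq (u.1, u.2.1 `|` u.2.2) | u <- t] (d, d)].

Definition par_sem (S1 S2 : set rseq) : set rseq :=
  [set s | exists s1 s2 : rseq, [/\ S1 s1, S2 s2 & par_seq s1 s2 s]].

Definition now_sem c (S1 S2 : set rseq) : set rseq :=
  [set s | let c' := (head (\bot, \bot) (rval s)).1 in
     ((c' ⊢ c) /\ S1 s) \/ (~ (c' ⊢ c) /\ S2 s)].

Definition cyl_seq x (s : seq (C * C)) : seq (C * C) :=
  [seq (cyl x u.1, cyl x u.2) | u <- s].

Definition connected x (s : seq (C * C)) : Prop :=
  cyl x (head (\bot, \bot) s).1 = (head (\bot, \bot) s).1 /\
  sorted (fun u u' => cyl x u'.1 `|` u.2 == u'.1) s.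

Definition invariant_seq x (s : seq (C * C)) : Prop :=
  {in s, forall u, u.2 = cyl x u.2 `|` u.1}.

Definition hide_sem x (S : set rseq) : set rseq :=
  [set s | exists s' : rseq,
     [/\ S s', cyl_seq x s = cyl_seq x s', connected x s'
       & invariant_seq x s]].

(* The least fixpoint of monotone operators, see [lfp_fix] and [lfp_least]. *)
Definition lfp (Psi : set rseq -> set rseq) : set rseq :=
  \bigcap_(f in [set f | Psi f `<=` f]) f.

(* [n] is the number of declarations in [D]; the recursive equations, without
   [n], are [den_tell], ..., [den_call] and [den_free]. *)
Fixpoint den_rec (n : nat) : decls -> agent -> env -> set rseq :=
  fix denA D A e {struct A} :=
    match A with
    | Tell c => tell_sem c
    | Ask n cs As => choice_sem cs (fun i => denA D (As i) e)
    | Now c A B => now_sem c (denA D A e) (denA D B e)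
    | Par A B => par_sem (denA D A e) (denA D B e)
    | Hide x A => hide_sem x (denA D A e)
    | Call p x =>
        match n, decl_body D p x with
        | n'.+1, Some B =>
            lfp (fun f => den_rec n' D.[~ p]%fmap B [eta e with p |-> f])
        | _, _ => e p
        end
    end.

Definition den (D : decls) (A : agent) (e : env) : set rseq :=
  den_rec #|` domf D| D A e.

Section DenotationFacts.
Implicit Types (D : decls) (A B : agent) (e : env) (S : set rseq).

Lemma lfp_least (Psi : set rseq -> set rseq) f :
  Psi f `<=` f -> lfp Psi `<=` f.
Proof. by move=> h s; apply. Qed.

Lemma lfp_fix (Psi : set rseq -> set rseq) :
  (forall f g, f `<=` g -> Psi f `<=` Psi g) -> Psi (lfp Psi) = lfp Psi.
Proof.
move=> mono; have sub : Psi (lfp Psi) `<=` lfp Psi.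
  move=> s hs f hf; apply: (hf s); apply: mono hs; exact: lfp_least.
by apply/seteqP; split=> //; apply: lfp_least; exact: mono.
Qed.

Lemma den_tell D c e : den D (Tell c) e = tell_sem c.
Proof. by rewrite /den; case: #|` domf D|. Qed.

Lemma den_ask D n (cs : 'I_n -> C) As e :
  den D (Ask cs As) e = choice_sem cs (fun i => den D (As i) e).
Proof. by rewrite /den; case: #|` domf D|. Qed.

Lemma den_stop D e : den D stop e = stop_sem.
Proof.
rewrite den_ask; apply/seteqP; split=> s.
  case=> [[? [? [h _]]]|[ds [es _]]] u; first by case: h.
  by rewrite es => /mapP[d _ ->].
move=> hs; right; exists (map fst (rval s)); split; last by move=> d _ [].
by rewrite -map_comp -[LHS]map_id; apply/eq_in_map => -[c d] /hs /= ->.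
Qed.

Lemma den_now D c A B e :
  den D (Now c A B) e = now_sem c (den D A e) (den D B e).
Proof. by rewrite /den; case: #|` domf D|. Qed.

Lemma den_par D A B e : den D (Par A B) e = par_sem (den D A e) (den D B e).
Proof. by rewrite /den; case: #|` domf D|. Qed.

Lemma den_hide D x A e : den D (Hide x A) e = hide_sem x (den D A e).
Proof. by rewrite /den; case: #|` domf D|. Qed.

Lemma den_call D p x B e : decl_body D p x = Some B ->
  den D (Call p x) e =
  lfp (fun f => den D.[~ p]%fmap B [eta e with p |-> f]).
Proof.
move=> h; rewrite /den; have pD : p \in domf D.
  by move: h; rewrite /decl_body; case: fndP.
have -> : #|` domf D| = (#|` domf (D.[~ p])%fmap|).+1.
  by rewrite domf_rem (cardfsD1 p (domf D)) pD.
by rewrite /= h.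
Qed.

Lemma den_free D p x e : p \notin D -> den D (Call p x) e = e p.
Proof.
move=> h; rewrite /den; case: #|` domf D| => //= n.
by rewrite /decl_body not_fnd.
Qed.

Lemma choice_mono n (cs : 'I_n -> C) (S S' : 'I_n -> set rseq) :
  (forall i, S i `<=` S' i) -> choice_sem cs S `<=` choice_sem cs S'.
Proof.
move=> h s [[ds [dm [i [s' [? ? ? hs]]]]]|?]; [left|by right].
by exists ds, dm, i, s'; split=> //; exact: h hs.
Qed.

Lemma now_mono c S1 S2 S1' S2' : S1 `<=` S1' -> S2 `<=` S2' ->
  now_sem c S1 S2 `<=` now_sem c S1' S2'.
Proof.
by move=> h1 h2 s [[? /h1]|[? /h2]]; [left|right].
Qed.

Lemma par_mono S1 S2 S1' S2' : S1 `<=` S1' -> S2 `<=` S2' ->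
  par_sem S1 S2 `<=` par_sem S1' S2'.
Proof.
by move=> h1 h2 s [s1 [s2 [/h1 ? /h2 ? ?]]]; exists s1, s2.
Qed.

Lemma hide_mono x S S' : S `<=` S' -> hide_sem x S `<=` hide_sem x S'.
Proof. by move=> h s [s' [? ? ? ?]]; exists s'; split=> //; apply: h. Qed.

Lemma den_rec_mono n D A e e' : (forall p, e p `<=` e' p) ->
  den_rec n D A e `<=` den_rec n D A e'.
Proof.
elim: n D A e e' => [|n IHn] D A e e' ee';
  elim: A => [c|k cs As IH|c A IA B IB|A IA B IB|x A IH|p x] //=;
  do ?[exact: choice_mono|exact: now_mono|exact: par_mono|exact: hide_mono].
case: (decl_body D p x) => [B|]; last exact: ee'.
move=> s hs f hf; apply: hs => t ht; apply: hf.
apply: IHn ht => q /=; case: eqP => _; last exact: ee'.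
exact: subset_refl.
Qed.

Lemma den_mono D A e e' : (forall p, e p `<=` e' p) ->
  den D A e `<=` den D A e'.
Proof. exact: den_rec_mono. Qed.

End DenotationFacts.

Inductive predvar : Type := InP | OutP | AuxP of nat.

Definition predvar_code (X : predvar) : option (option nat) :=
  match X with
  | InP => None | OutP => Some None | AuxP n => Some (Some n)
  end.
Definition predvar_decode (o : option (option nat)) : predvar :=
  match o with
  | None => InP | Some None => OutP | Some (Some n) => AuxP n
  end.
Lemma predvar_codeK : cancel predvar_code predvar_decode.
Proof. by case. Qed.
HB.instance Definition _ := Countable.copy predvar (can_type predvar_codeK).

Inductive cterm : Type :=
  | TVar of cvar
  | TCst of C
  | TJoin of cterm & cterm
  | TCyl of csvar & cterm.

(* A predicate variable is applied either to a constraint, [FAtom], or to a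
   constraint variable, [FVal]; see [truth] for their different meanings. *)
Inductive formula : Type :=
  | FLe of cterm & cterm
  | FAtom of predvar & C
  | FVal of predvar & cvar
  | FNot of formula
  | FAnd of formula & formula
  | FExCs of csvar & formula
  | FExC of cvar & formula
  | FExP of predvar & formula
  | FNext of formula
  | FUntil of formula & formula.

Definition FTrue : formula := FLe (TCst \bot) (TCst \bot).
Definition FFalse : formula := FNot FTrue.
Definition FEq t u : formula := FAnd (FLe t u) (FLe u t).
Definition FOr phi psi : formula := FNot (FAnd (FNot phi) (FNot psi)).
Definition FImp phi psi : formula := FOr (FNot phi) psi.
Definition FIff phi psi : formula := FAnd (FImp phi psi) (FImp psi phi).
Definition FAllC p phi : formula := FNot (FExC p (FNot phi)).
Definition FEventually phi : formula := FUntil FTrue phi.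
Definition FAlways phi : formula := FNot (FEventually (FNot phi)).
Definition FBigOr n (phi : 'I_n -> formula) : formula :=
  \big[FOr/FFalse]_(i < n) phi i.
Definition FBigAnd n (phi : 'I_n -> formula) : formula :=
  \big[FAnd/FTrue]_(i < n) phi i.

Definition pasg : Type := predvar -> C.
Definition casg : Type := cvar -> C.

(* Monotonicity of a sequence of predicate assignments is split in two: the
   part concerning each predicate variable separately, and the part relating
   the distinguished variables.  Sequences reached through a quantifier are
   only subject to the former.  The latter is not invariant under replacing
   [OutP] by another variable, so if quantifiers were bound by it, textual
   substitution for [OutP] would not correspond to updating its value: take
   the formula "for all I, O entails I". *)
Definition pointwise_monotone (rho : seq pasg) : Prop :=
  Sorted (fun v w => forall X, w X ⊢ v X) rho.

Definition monotonic (rho : seq pasg) : Prop :=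
  [/\ pointwise_monotone rho,
      List.Forall (fun v => v OutP ⊢ v InP) rho
    & Sorted (fun v w => w InP ⊢ v OutP) rho].

Definition trace (rho : seq pasg) : seq (C * C) :=
  [seq (v InP, v OutP) | v <- rho].

Fixpoint term_val (gamma : casg) (t : cterm) : C :=
  match t with
  | TVar p => gamma p
  | TCst c => c
  | TJoin t u => term_val gamma t `|` term_val gamma u
  | TCyl x t => cyl x (term_val gamma t)
  end.

Definition first (rho : seq pasg) : pasg := head (fun _ => \bot) rho.

Definition next (rho : seq pasg) : seq pasg :=
  if (1 < size rho)%N then behead rho else rho.

(* X(c) says that the value of X entails the constraint c, whereas X(p), for
   a constraint variable p, says that the value of X is p.  The axioms which
   quantify over p depend on this: reading X(p) as entailment, the formula
   "for all p, O(p) implies I(q) and q lub c = p for some q" fails for tell(c)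
   with p = true, for every c other than true. *)
Fixpoint truth (rho : seq pasg) (gamma : casg) (phi : formula) : Prop :=
  match phi with
  | FLe t u => term_val gamma u ⊢ term_val gamma t
  | FAtom X c => first rho X ⊢ c
  | FVal X p => first rho X = gamma p
  | FNot phi => ~ truth rho gamma phi
  | FAnd phi psi => truth rho gamma phi /\ truth rho gamma psi
  | FExCs x phi => exists rho',
      [/\ pointwise_monotone rho',
          Forall2 (fun v v' => forall X, cyl x (v X) = cyl x (v' X)) rho rho'
        & truth rho' gamma phi]
  | FExC p phi => exists c, truth rho [eta gamma with p |-> c] phi
  | FExP X phi => exists rho',
      [/\ pointwise_monotone rho',
          Forall2 (fun v v' => forall Y, Y != X -> v Y = v' Y) rho rho'
        & truth rho' gamma phi]
  | FNext phi => truth (next rho) gamma phi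
  | FUntil phi psi => exists k : nat,
      [/\ (k < size rho)%N,
          truth (drop k rho) gamma psi
        & forall j : nat, (j < k)%N -> truth (drop j rho) gamma phi]
  end.

Definition models (rho : seq pasg) (phi : formula) : Prop :=
  forall gamma, truth rho gamma phi.

Definition valid (phi : formula) : Prop :=
  forall rho, rho != [::] -> monotonic rho -> models rho phi.

Definition valid_sat (e : env) (D : decls) (A : agent) (phi : formula) : Prop :=
  forall rho, monotonic rho ->
    (exists2 s : rseq, den D A e s & rval s = trace rho) -> models rho phi.

Fixpoint fpv (phi : formula) : seq predvar :=
  match phi with
  | FLe _ _ => [::]
  | FAtom X _ | FVal X _ => [:: X]
  | FNot phi | FExCs _ phi | FExC _ phi | FNext phi => fpv phi
  | FAnd phi psi | FUntil phi psi => fpv phi ++ fpv psi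
  | FExP X phi => [seq Y <- fpv phi | Y != X]
  end.

Definition aux_index (X : predvar) : nat := if X is AuxP n then n else 0.
Definition fresh (s : seq predvar) : predvar :=
  AuxP (\max_(X <- s) aux_index X)%N.+1.

(* Capture-avoiding simultaneous renaming: a bound variable is only renamed
   when it would capture. *)
Fixpoint rename (sigma : predvar -> predvar) (phi : formula) : formula :=
  match phi with
  | FLe t u => FLe t u
  | FAtom X c => FAtom (sigma X) c
  | FVal X p => FVal (sigma X) p
  | FNot phi => FNot (rename sigma phi)
  | FAnd phi psi => FAnd (rename sigma phi) (rename sigma psi)
  | FExCs x phi => FExCs x (rename sigma phi)
  | FExC p phi => FExC p (rename sigma phi)
  | FExP Z phi =>
      let used := [seq sigma Y | Y <- fpv phi & Y != Z] in
      let Z' := if Z \in used then fresh used else Z in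
      FExP Z' (rename [eta sigma with Z |-> Z'] phi)
  | FNext phi => FNext (rename sigma phi)
  | FUntil phi psi => FUntil (rename sigma phi) (rename sigma psi)
  end.

Definition subst_out (phi : formula) (X : predvar) : formula :=
  rename [eta id with OutP |-> X] phi.

Definition stut : formula :=
  FAllC 0 (FIff (FVal OutP 0) (FVal InP 0)).

Definition tell_formula c : formula :=
  FAnd (FAtom OutP c)
    (FAnd (FAllC 0 (FImp (FVal OutP 0)
             (FExC 1 (FAnd (FVal InP 1)
                           (FEq (TJoin (TVar 1) (TCst c)) (TVar 0))))))
          (FNext (FAlways stut))).

Definition no_ask n (cs : 'I_n -> C) : formula :=
  FAnd (FBigAnd (fun j => FNot (FAtom InP (cs j)))) stut.

Definition ask_formula n (cs : 'I_n -> C) (phi : 'I_n -> formula) : formula :=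
  FOr (FBigOr (fun i =>
         FUntil (no_ask cs)
           (FAnd (FAtom InP (cs i)) (FAnd stut (FNext (phi i))))))
      (FAlways (no_ask cs)).

Definition now_formula c (phi psi : formula) : formula :=
  FOr (FAnd (FAtom InP c) phi) (FAnd (FNot (FAtom InP c)) psi).

Definition FNeqCyl x p : formula := FNot (FEq (TCyl x (TVar p)) (TVar p)).

Definition loc x : formula :=
  FAllC 0 (FImp (FNeqCyl x 0)
    (FAnd (FNot (FVal InP 0))
       (FAlways (FImp (FNext (FVal InP 0))
          (FExC 1 (FAnd (FVal OutP 1)
             (FEq (TJoin (TCyl x (TVar 0)) (TVar 1)) (TVar 0)))))))).

Definition inv x : formula :=
  FAllC 0 (FAlways (FImp (FNeqCyl x 0)
    (FImp (FVal OutP 0)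
       (FExC 1 (FAnd (FVal InP 1)
          (FEq (TJoin (TCyl x (TVar 0)) (TVar 1)) (TVar 0))))))).

Definition par (X Y : predvar) : formula :=
  FAllC 0 (FAlways (FIff (FVal OutP 0)
    (FExC 1 (FExC 2 (FAnd (FVal X 1) (FAnd (FVal Y 2)
       (FEq (TJoin (TVar 1) (TVar 2)) (TVar 0)))))))).

Record assertion : Type :=
  Sat { sat_decls : decls; sat_agent : agent; sat_formula : formula }.

(* In the recursion rule the assumptions made about p, other than the one
   which the rule discharges, are not available in the premise: there p stands
   for the recursive procedure and not for its value in the environment. *)
Definition rec_assumptions (Gamma : set assertion) (D : decls) p x
    (phi : formula) : set assertion :=
  ([set a | Gamma a /\ ~ free_pvar p (sat_decls a) (sat_agent a)]
  `|` [set Sat D.[~ p]%fmap (Call p x) phi])%classic.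

Inductive derivable :
    set assertion -> decls -> agent -> formula -> Prop :=
  | D_assumption (Gamma : set assertion) D A phi :
      Gamma (Sat D A phi) -> derivable Gamma D A phi
  | D_tell Gamma D c :
      derivable Gamma D (Tell c) (tell_formula c)
  | D_ask Gamma D n (cs : 'I_n -> C) (As : 'I_n -> agent)
      (phi : 'I_n -> formula) :
      (forall i, derivable Gamma D (As i) (phi i)) ->
      derivable Gamma D (Ask cs As) (ask_formula cs phi)
  | D_now Gamma D c A B phi psi :
      derivable Gamma D A phi -> derivable Gamma D B psi ->
      derivable Gamma D (Now c A B) (now_formula c phi psi)
  | D_hide Gamma D x A phi :
      derivable Gamma D A phi ->
      derivable Gamma D (Hide x A)
        (FAnd (FExCs x (FAnd phi (loc x))) (inv x))
  | D_par Gamma D A B phi psi X Y :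
      X != Y -> X \notin fpv phi ++ fpv psi -> Y \notin fpv phi ++ fpv psi ->
      derivable Gamma D A phi -> derivable Gamma D B psi ->
      derivable Gamma D (Par A B)
        (FExP X (FExP Y
           (FAnd (subst_out phi X) (FAnd (subst_out psi Y) (par X Y)))))
  | D_rec Gamma D p x A phi :
      decl_body D p x = Some A ->
      derivable (rec_assumptions Gamma D p x phi) D.[~ p]%fmap A phi ->
      derivable Gamma D (Call p x) phi
  | D_conseq Gamma D A phi psi :
      derivable Gamma D A phi -> valid (FImp phi psi) ->
      derivable Gamma D A psi.

End Tccp.

Arguments agent {disp} C.
Arguments decls {disp} C.
Arguments rseq {disp} C.
Arguments env {disp} C.
Arguments cterm {disp} C.
Arguments formula {disp} C.
Arguments assertion {disp} C.

(* Main.v *)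
(* Soundness is proved rule by rule, for all environments at once.  In the
   recursion rule, the set of all the sequences which satisfy the formula is a
   prefixpoint of the operator associated with the body, by the induction
   hypothesis for the environment which maps the procedure to this set; hence
   it contains the least fixpoint.  For the hiding and parallel rules, the
   reactive sequences of the components provide the values of the quantified
   variables. *)
Require Import Defs.

Set Implicit Arguments.
Unset Strict Implicit.
Unset Printing Implicit Defensive.

Import Order.TTheory.

Local Open Scope classical_set_scope.
Local Open Scope order_scope.

(** * List predicates expressed through positions *)

Section ListsByIndex.
Context {T U : Type} (x0 : T) (y0 : U).

Lemma Sorted_nth (R : T -> T -> Prop) (s : seq T) :
  Sorted R s <->
  forall k : nat, (k.+1 < size s)%N -> R (nth x0 s k) (nth x0 s k.+1).
Proof.
elim: s => [|x s IHs]; first by split=> // _; constructor.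
split=> [hs [|k] hk|hs].
- have [_ hx] := Sorted_inv hs.
  by case: s hx hk {IHs hs} => //= y s hx _; exact: HdRel_inv hx.
- by have [/IHs hs' _] := Sorted_inv hs; exact: hs'.
- constructor; first by apply/IHs => k hk; exact: (hs k.+1).
  case: s hs {IHs} => [|y s] hs; constructor; exact: (hs 0%N).
Qed.

Lemma Forall_nth (P : T -> Prop) (s : seq T) :
  List.Forall P s <-> forall k : nat, (k < size s)%N -> P (nth x0 s k).
Proof.
elim: s => [|x s IHs]; first by split=> // _; constructor.
split=> [hs|hs].
  by inversion_clear hs => -[|k] //= hk; move/IHs: H0; apply.
constructor; first exact: (hs 0%N).
by apply/IHs => k hk; exact: (hs k.+1).
Qed.

Lemma Forall2_nth (R : T -> U -> Prop) (s : seq T) (t : seq U) :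
  Forall2 R s t <->
  size s = size t /\
  forall k : nat, (k < size s)%N -> R (nth x0 s k) (nth y0 t k).
Proof.
elim: s t => [|x s IHs] [|y t].
- by split=> // _; constructor.
- by split=> [h|[]//]; inversion h.
- by split=> [h|[]//]; inversion h.
split=> [h|[/= [est] h]].
  inversion_clear h; have [est hst] := (IHs t).1 H0.
  by split=> [|[|k]] //=; [rewrite est|exact: hst].
constructor; first exact: (h 0%N).
by apply/IHs; split=> // k hk; exact: (h k.+1).
Qed.

End ListsByIndex.

Section Soundness.
Context {disp : Order.disp_t} {C : cylindricType disp}.
Implicit Types (c d : C) (rho : seq (@pasg disp C)) (gamma : @casg disp C).
Implicit Types (phi psi : formula C) (D : decls C) (A B : agent C) (e : env C).
Implicit Types (x y : nat) (X Y Z : predvar) (s t : seq (C * C)) (k n : nat).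

(** * Dependence of the denotation on the environment *)

Lemma calls_variant p y x A z :
  calls p y (variant x A z : agent C) = calls p y A.
Proof. by rewrite /variant; case: eqP. Qed.

Lemma free_pvar_sub p D A B :
  (forall y, calls p y A -> calls p y B) ->
  free_pvar p D A -> free_pvar p D B.
Proof.
by move=> hAB [pD [y hy]]; split=> //; exists y; case: hy => [/hAB|];
  [left|right].
Qed.

Lemma free_pvar_call p x D : p \notin D -> free_pvar p D (Call p x : agent C).
Proof. by split=> //; exists x; left; rewrite /= !eqxx. Qed.

(** Passing to a variant adds no calls, so a call made in [B] already occurs in the declaration of
    [p] stored in [D]. Removing [p] from [D] makes only [p] itself free, and [q] differs from it. *)
Lemma free_pvar_body p q x D B : decl_body D p x = Some B -> q != p ->
  free_pvar q D.[~ p]%fmap B -> free_pvar q D (Call p x).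
Proof.
rewrite /decl_body; case hD : D.[? p]%fmap => [[x' B']|] //= [<-] qp.
case=> qD [y hy]; split.
  by apply: contra qD => qD; rewrite mem_remf1 qp.
exists y; right; case: hy => [|[r [z [B1 [hr hB1]]]]].
  by rewrite calls_variant => hy; exists p, x', B'.
by exists r, z, B1; split=> //; move: hr; rewrite fnd_rem1; case: eqP.
Qed.

(** Induction on the number of declarations, then on the agent: unfolding a call removes one
    declaration. In the recursion rule this transports the retained assumptions to the environment
    in which the procedure is reassigned. *)
Lemma den_eq_free D A e e' :
  (forall p, free_pvar p D A -> e p = e' p) -> den D A e = den D A e'.
Proof.
have [n] := ubnP #|` domf D|%fset.
elim: n D A e e' => // n IHn D A e e' hn.
elim: A => [c|m cs As IH|c A IA B IB|A IA B IB|x A IH|p x] hfree.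
- by rewrite !den_tell.
- rewrite !den_ask; congr choice_sem; apply: funext => i; apply: IH => p hp.
  by apply: hfree; apply: free_pvar_sub hp => y hy; apply/existsP; exists i.
- rewrite !den_now IA ?IB // => p hp; apply: hfree; apply: free_pvar_sub hp;
  by move=> y /= ->; rewrite ?orbT.
- rewrite !den_par IA ?IB // => p hp; apply: hfree; apply: free_pvar_sub hp;
  by move=> y /= ->; rewrite ?orbT.
- by rewrite !den_hide IH // => p hp; apply: hfree; apply: free_pvar_sub hp.
have [pD|pD] := boolP (p \in domf D); last first.
  by rewrite !den_free //; apply/hfree/free_pvar_call.
have hB : decl_body D p x =
    Some (variant (D.[pD]).1 (D.[pD]).2 x)%fmap by rewrite /decl_body in_fnd.
rewrite !(den_call _ hB); congr lfp; apply: funext => f.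
apply: IHn => [|q hq].
  by move: hn; rewrite domf_rem (cardfsD1 p (domf D)) pD.
(* At [p] both updated environments return [f]; elsewhere a free variable of the body is free in the
   call. *)
rewrite /=; case: eqP => // /eqP qp; apply: hfree.
exact: free_pvar_body hB qp hq.
Qed.

(** * Sequences of predicate assignments, position by position *)

Definition val rho k : @pasg disp C := nth (fun _ => \bot) rho k.

Lemma pointwise_monotoneP rho : pointwise_monotone rho <->
  forall k X, (k.+1 < size rho)%N -> val rho k X <= val rho k.+1 X.
Proof.
rewrite /pointwise_monotone (Sorted_nth (fun _ => \bot)).
by split=> h k; [move=> X|]; move=> hk; [exact: h|move=> X; exact: h].
Qed.

Lemma monotonicP rho : monotonic rho <->
  [/\ forall k X, (k.+1 < size rho)%N -> val rho k X <= val rho k.+1 X,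
      forall k, (k < size rho)%N -> val rho k InP <= val rho k OutP
    & forall k, (k.+1 < size rho)%N -> val rho k OutP <= val rho k.+1 InP].
Proof.
rewrite /monotonic (propext (pointwise_monotoneP rho)).
rewrite (propext (Forall_nth (fun _ => \bot) _ _)).
by rewrite (propext (Sorted_nth (fun _ => \bot) _ _)).
Qed.

Lemma val_drop m rho k : val (drop m rho) k = val rho (m + k).
Proof. by rewrite /val nth_drop. Qed.

Lemma pointwise_monotone_drop m rho :
  pointwise_monotone rho -> pointwise_monotone (drop m rho).
Proof.
rewrite !pointwise_monotoneP => h k X hk; rewrite !val_drop addnS; apply: h.
by move: hk; rewrite size_drop ltn_subRL addnS.
Qed.

Lemma monotonic_drop m rho : monotonic rho -> monotonic (drop m rho).
Proof.
rewrite !monotonicP size_drop => -[h1 h2 h3].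
split=> [k X|k|k]; rewrite ltn_subRL ?addnS => hk; rewrite !val_drop ?addnS.
- exact: h1.
- exact: h2.
- exact: h3.
Qed.

(** The test is coerced to the number of states dropped, 0 or 1; as a [drop], [next] composes with
    the suffixes taken by the temporal operators. *)
Lemma nextE rho : next rho = drop (1 < size rho)%N rho.
Proof. by rewrite /next; case: ifP => _; rewrite ?drop1 ?drop0. Qed.

Lemma firstE rho : first rho = val rho 0.
Proof. by rewrite /val nth0. Qed.

Lemma nth_trace rho k :
  nth (\bot, \bot) (trace rho) k = (val rho k InP, val rho k OutP).
Proof.
have [hk|hk] := ltnP k (size rho); first by rewrite (nth_map (fun _ => \bot)).
by rewrite /val !nth_default ?size_map.
Qed.

(** * Meaning of the derived connectives and of the formulas used in the rules *)

Lemma truth_or rho gamma phi psi :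
  truth rho gamma (FOr phi psi) = (truth rho gamma phi \/ truth rho gamma psi).
Proof. by rewrite /= -not_orE notK. Qed.

Lemma truth_imp rho gamma phi psi :
  truth rho gamma (FImp phi psi) = (truth rho gamma phi -> truth rho gamma psi).
Proof. by rewrite truth_or implyE. Qed.

Lemma truth_iff rho gamma phi psi :
  truth rho gamma (FIff phi psi) =
  (truth rho gamma phi <-> truth rho gamma psi).
Proof.
have -> : truth rho gamma (FIff phi psi) =
  (truth rho gamma (FImp phi psi) /\ truth rho gamma (FImp psi phi)) by [].
by rewrite !truth_imp.
Qed.

Lemma truth_allC rho gamma p phi :
  truth rho gamma (FAllC p phi) =
  forall c, truth rho [eta gamma with p |-> c] phi.
Proof.
apply: propext; split=> /= [h c|h [c]]; last by apply; exact: h.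
by apply: contrapT => hc; apply: h; exists c.
Qed.

Lemma truth_always rho gamma phi :
  truth rho gamma (FAlways phi) =
  forall k, (k < size rho)%N -> truth (drop k rho) gamma phi.
Proof.
apply: propext; split=> /= [h k hk|h [k [hk hn _]]]; last exact/hn/h.
by apply: contrapT => hn; apply: h; exists k.
Qed.

Lemma le_and_eq c d : c <= d /\ d <= c <-> c = d.
Proof. by split=> [[h h']|->] //; apply/eqP; rewrite eq_le h h'. Qed.

Lemma truth_bigor rho gamma n (phi : 'I_n -> formula C) :
  truth rho gamma (FBigOr phi) <-> exists i, truth rho gamma (phi i).
Proof.
rewrite /FBigOr.
have -> : (exists i, truth rho gamma (phi i)) <->
    (exists2 i, i \in index_enum 'I_n & truth rho gamma (phi i)).
  by split=> -[i]; exists i; rewrite ?mem_index_enum.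
elim: (index_enum _) => [|j r IHr].
  by rewrite big_nil; split=> [|[]//] /=; case.
rewrite big_cons truth_or IHr; split.
  case=> [hj|[i ir hi]]; first by exists j; rewrite ?mem_head.
  by exists i => //; rewrite inE ir orbT.
case=> i; rewrite inE => /orP[/eqP->|ir hi]; [by left|right].
by exists i.
Qed.

Lemma truth_bigand rho gamma n (phi : 'I_n -> formula C) :
  truth rho gamma (FBigAnd phi) <-> forall i, truth rho gamma (phi i).
Proof.
rewrite /FBigAnd.
have -> : (forall i, truth rho gamma (phi i)) <->
    {in index_enum 'I_n, forall i, truth rho gamma (phi i)}.
  by split=> [h i _ //|h i]; exact/h/mem_index_enum.
elim: (index_enum _) => [|j r IHr].
  by rewrite big_nil; split=> //= _; exact: lexx.
rewrite big_cons /= IHr; split.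
  by case=> hj hr i; rewrite inE => /orP[/eqP->|/hr].
by move=> h; split=> [|i ir]; apply: h; rewrite inE ?eqxx ?ir ?orbT.
Qed.

(** As [FVal] is an equality, the instance of the quantifier at the output value already forces the
    two values to coincide. The same instance, taken in each state, gives [truth_par]. *)
Lemma truth_stut rho gamma :
  truth rho gamma stut = (val rho 0 OutP = val rho 0 InP).
Proof.
rewrite truth_allC -!firstE.
apply: propext; split=> [/(_ (first rho OutP))|h c].
  by rewrite truth_iff /= => -[-> ].
by rewrite truth_iff /= h.
Qed.

Lemma truth_par rho gamma X Y : truth rho gamma (par X Y) =
  forall k, (k < size rho)%N -> val rho k OutP = val rho k X `|` val rho k Y.
Proof.
rewrite truth_allC; apply: propext; split=> [h k hk|h c].
  move: (h (val rho k OutP)); rewrite truth_always => /(_ k hk).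
  rewrite truth_iff => -[hO _]; case: hO => [|a [b [ha [hb]]]].
    by rewrite /= firstE val_drop addn0.
  move=> /le_and_eq; move: ha hb => /=.
  by rewrite !firstE !val_drop addn0 => -> ->.
rewrite truth_always => k hk; rewrite truth_iff; split.
  rewrite [X in X -> _]/= firstE val_drop addn0 h // => hc.
  exists (val rho k X), (val rho k Y).
  by rewrite /= !firstE !val_drop addn0 hc; repeat split.
case=> a [b [ha [hb]]]; move=> /le_and_eq; move: ha hb => /=.
by rewrite !firstE !val_drop addn0 h // => -> ->.
Qed.

(** The first two hypotheses are [x]-connectedness. The third handles the last state, where [next]
    does not move: there the input is compared with the output of the same state, and joining it
    with its own cylindrification, which is below it, changes nothing. *)
Lemma truth_loc rho gamma x :
  cyl x (val rho 0 InP) = val rho 0 InP ->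
  (forall k, (k.+1 < size rho)%N ->
    cyl x (val rho k.+1 InP) `|` val rho k OutP = val rho k.+1 InP) ->
  (forall k, size rho = k.+1 -> val rho k InP = val rho k OutP) ->
  truth rho gamma (loc x).
Proof.
move=> h0 hS hlast; rewrite truth_allC => c; rewrite truth_imp => hc; split.
  move=> h; apply: hc; apply/le_and_eq; move: h; rewrite /= firstE.
  by move=> <-.
rewrite truth_always => k hk; rewrite truth_imp => hI.
exists (val rho k OutP); split; first by rewrite /= firstE val_drop addn0.
apply/le_and_eq; move: hI; rewrite /= firstE nextE size_drop !val_drop addn0.
have [hk1|hk1] := boolP (1 < size rho - k)%N => <-.
  by rewrite addn1; apply: hS; rewrite ltn_subRL addn1 in hk1.
have sk : size rho = k.+1.
  by apply/eqP; rewrite eqn_leq hk andbT -addn1 -leq_subLR leqNgt.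
by rewrite addn0 -hlast //; apply/join_r/cyl_le.
Qed.

Lemma truth_inv rho gamma x :
  (forall k, (k < size rho)%N ->
    cyl x (val rho k OutP) `|` val rho k InP = val rho k OutP) ->
  truth rho gamma (inv x).
Proof.
move=> h; rewrite truth_allC => c; rewrite truth_always => k hk.
rewrite !truth_imp => _ hO; exists (val rho k InP); split.
  by rewrite /= firstE val_drop addn0.
apply/le_and_eq; move: hO; rewrite /= firstE val_drop addn0 => <-.
exact: h.
Qed.

Lemma truth_no_ask rho gamma n (cs : 'I_n -> C) :
  truth rho gamma (no_ask cs) <->
  (forall i, ~ (cs i <= val rho 0 InP)) /\ val rho 0 OutP = val rho 0 InP.
Proof.
have -> : truth rho gamma (no_ask cs) =
  (truth rho gamma (FBigAnd (fun j => FNot (FAtom InP (cs j)))) /\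
   truth rho gamma stut) by [].
by rewrite truth_stut (propext (truth_bigand _ _ _)) /= firstE.
Qed.

(** The bound on the size makes [next] skip the first state, the one in which [c] is added and which
    therefore may fail to stutter. *)
Lemma truth_tell rho gamma c :
  val rho 0 OutP = val rho 0 InP `|` c -> (1 < size rho)%N ->
  (forall k, (0 < k < size rho)%N -> val rho k OutP = val rho k InP) ->
  truth rho gamma (tell_formula c).
Proof.
move=> h0 sz hS; split; first by rewrite /= firstE h0 leUr.
split.
  rewrite truth_allC => d; rewrite truth_imp /= firstE h0 => <-.
  by exists (val rho 0 InP); split=> //; exact/le_and_eq.
have -> : truth rho gamma (FNext (FAlways stut)) =
  truth (next rho) gamma (FAlways stut) by [].
rewrite truth_always nextE sz => k; rewrite size_drop ltn_subRL => hk.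
by rewrite truth_stut !val_drop addn0 hS.
Qed.

(** * Reassigning and renaming predicate variables *)

Definition reassign (g : predvar -> option predvar) rho' rho :=
  mkseq (fun k X => if g X is Some Y then val rho' k Y else val rho k X)
    (size rho).

Lemma size_reassign g rho' rho : size (reassign g rho' rho) = size rho.
Proof. exact: size_mkseq. Qed.

(** The index is unbounded because, for equal sizes, both sides are [\bot] past the end. *)
Lemma val_reassign g rho' rho k X : size rho' = size rho ->
  val (reassign g rho' rho) k X =
  if g X is Some Y then val rho' k Y else val rho k X.
Proof.
move=> es; have [hk|hk] := ltnP k (size rho); first by rewrite /val nth_mkseq.
rewrite /val nth_default ?size_reassign //.
by case: (g X) => [Y|]; rewrite nth_default // es.
Qed.

(** Pointwise monotonicity never compares two distinct predicate variables, so each one may take its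
    history from another sequence and under another name. All witnesses for quantifiers over
    sequences are built in this way. *)
Lemma pointwise_monotone_reassign g rho' rho : size rho' = size rho ->
  pointwise_monotone rho' -> pointwise_monotone rho ->
  pointwise_monotone (reassign g rho' rho).
Proof.
rewrite !pointwise_monotoneP size_reassign => es h' h k X hk.
rewrite !val_reassign //; case: (g X) => [Y|]; last exact: h.
by apply: h'; rewrite es.
Qed.

Lemma monotonic_pointwise rho : monotonic rho -> pointwise_monotone rho.
Proof. by case. Qed.

Lemma fresh_notin (r : seq predvar) : fresh r \notin r.
Proof.
apply/negP => hr; have /= := @leq_bigmax_seq _ r xpredT aux_index _ hr isT.
by rewrite ltnn.
Qed.

Lemma Forall2_val (R : @pasg disp C -> @pasg disp C -> Prop) rho rho' :
  Forall2 R rho rho' <-> size rho = size rho' /\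
  forall k, (k < size rho)%N -> R (val rho k) (val rho' k).
Proof. exact: Forall2_nth. Qed.

Lemma fpv_cat phi psi :
  {subset fpv phi <= fpv phi ++ fpv psi} /\
  {subset fpv psi <= fpv phi ++ fpv psi}.
Proof. by split=> X hX; rewrite mem_cat hX ?orbT. Qed.

(* Injectivity is needed for [FExCs], which lets the values of distinct
   predicate variables vary independently. *)
Lemma truth_rename phi (sigma : predvar -> predvar) rho rho1 gamma :
  pointwise_monotone rho -> pointwise_monotone rho1 ->
  {in fpv phi &, injective sigma} -> size rho = size rho1 ->
  (forall k, {in fpv phi, forall X, val rho k (sigma X) = val rho1 k X}) ->
  truth rho gamma (rename sigma phi) <-> truth rho1 gamma phi.
Proof.
elim: phi sigma rho rho1 gamma => [u w|X c|X p|phi IH|phi IH1 psi IH2|x phi IH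
  |p phi IH|Z phi IH|phi IH|phi IH1 psi IH2] sigma rho rho1 gamma
  mono mono1 inj es agree.
- by [].
- by rewrite /= !firstE agree ?mem_head.
- by rewrite /= !firstE agree ?mem_head.
- by rewrite /= (propext (IH sigma rho rho1 gamma _ _ _ _ _)).
- have [sub1 sub2] := fpv_cat phi psi.
  have -> : truth rho1 gamma (FAnd phi psi) =
      (truth rho gamma (rename sigma phi) /\
       truth rho gamma (rename sigma psi)).
    congr and; apply/esym/propext.
      by apply: IH1 => // [|k X /sub1]; [exact: sub_in2 inj|exact: agree].
    by apply: IH2 => // [|k X /sub2]; [exact: sub_in2 inj|exact: agree].
  by [].
- split=> -[rho' [mono' /Forall2_val[es' cyl'] h]].
    (* Free variables of [phi] read their renamed copy in [rho']; the others keep their value, which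
       trivially agrees up to [cyl x]. *)
    pose g X := if X \in fpv phi then Some (sigma X) else None.
    have es1 : size rho' = size rho1 by rewrite -es'.
    exists (reassign g rho' rho1); split.
    + exact: pointwise_monotone_reassign.
    + apply/Forall2_val; rewrite size_reassign; split=> // k hk X.
      rewrite val_reassign // /g; case: ifP => // hX.
      by rewrite -cyl' ?es // agree.
    + apply: (IH sigma rho' _ gamma mono' _ inj _ _).1 h;
        rewrite ?size_reassign //.
        exact: pointwise_monotone_reassign.
      by move=> k X hX; rewrite val_reassign // /g hX.
  (* Conversely, [g] is the partial inverse of [sigma] on the free variables, found by position in
     the list; injectivity makes it independent of the choice of a preimage. *)
  pose g W := let i := index W (map sigma (fpv phi)) in
    if (i < size (fpv phi))%N then Some (nth InP (fpv phi) i) else None.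
  have gP X : X \in fpv phi -> g (sigma X) = Some X.
    move=> hX; rewrite /g; have hs := map_f sigma hX.
    rewrite -(size_map sigma) index_mem hs; congr Some.
    apply: inj => //; first by rewrite mem_nth // -(size_map sigma) index_mem.
    by rewrite -(nth_map InP InP) ?nth_index // -(size_map sigma) index_mem.
  have gN W : if g W is Some X then X \in fpv phi /\ sigma X = W else True.
    rewrite /g; case: ifP => // hi; split; first exact: mem_nth.
    by rewrite -(nth_map InP InP) // nth_index // -index_mem size_map.
  have es1 : size rho' = size rho by rewrite -es' es.
  exists (reassign g rho' rho); split.
  + exact: pointwise_monotone_reassign.
  + apply/Forall2_val; rewrite size_reassign; split=> // k hk W.
    rewrite val_reassign //; case: (g W) (gN W) => // X [hX <-].
    by rewrite -cyl' -?es // agree.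
  + apply: (IH sigma _ rho' gamma _ mono' inj _ _).2 h;
      rewrite ?size_reassign //.
      exact: pointwise_monotone_reassign.
    by move=> k X hX; rewrite val_reassign // gP.
- by split=> -[c hc]; exists c; [apply: (IH _ _ _ _ _ _ inj es agree).1 hc
    |apply: (IH _ _ _ _ _ _ inj es agree).2 hc].
- rewrite /=; set used := [seq sigma Y | Y <- fpv phi & Y != Z].
  set Z' := if _ then _ else _; set sigma' := (X in rename X _).
  (* No other free variable is sent to [Z']: this excludes capture and keeps the extended renaming
     [sigma'] injective. *)
  have hZ' : Z' \notin used.
    by rewrite /Z'; case: ifPn => // _; exact: fresh_notin.
  have fv X : X \in fpv phi -> X != Z -> X \in fpv (FExP Z phi).
    by move=> hX XZ; rewrite mem_filter XZ.
  have sZ : sigma' Z = Z' by rewrite /sigma' /= eqxx.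
  have sN X : X != Z -> sigma' X = sigma X by rewrite /sigma' /= => /negPf->.
  have sZ' X : X \in fpv phi -> X != Z -> sigma X != Z'.
    move=> hX XZ; apply: contraNneq hZ' => <-; apply: map_f.
    by rewrite mem_filter XZ.
  have inj' : {in fpv phi &, injective sigma'}.
    move=> X Y hX hY; have [->|XZ] := eqVneq X Z; have [->|YZ] := eqVneq Y Z.
    + by [].
    + by rewrite sZ sN // => /esym/eqP; rewrite (negPf (sZ' _ hY YZ)).
    + by rewrite sZ sN // => /eqP; rewrite (negPf (sZ' _ hX XZ)).
    + by rewrite !sN //; apply: inj; exact: fv.
  split=> -[rho' [mono' /Forall2_val[es' eq'] h]].
    (* Only the bound variable changes: its value is carried from [Z'] back to [Z], and the converse
       direction carries it from [Z] to [Z']. *)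
    pose g X := if X == Z then Some Z' else None.
    have es1 : size rho' = size rho1 by rewrite -es'.
    exists (reassign g rho' rho1); split.
    + exact: pointwise_monotone_reassign.
    + apply/Forall2_val; rewrite size_reassign; split=> // k hk X XZ.
      by rewrite val_reassign // /g (negPf XZ).
    + apply: (IH sigma' rho' _ gamma mono' _ inj' _ _).1 h;
        rewrite ?size_reassign //.
        exact: pointwise_monotone_reassign.
      move=> k X hX; rewrite val_reassign // /g.
      have [->|XZ] := eqVneq X Z; first by rewrite sZ.
      rewrite sN // -agree ?fv //.
      (* [Forall2] gives agreement only within the sequence; beyond it both values are the
         default. *)
      have [hk|hk] := ltnP k (size rho); first by rewrite eq' ?sZ'.
      by rewrite /val !nth_default // -es'.
  pose g X := if X == Z' then Some Z else None.
  have es1 : size rho' = size rho by rewrite -es' es.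
  exists (reassign g rho' rho); split.
  + exact: pointwise_monotone_reassign.
  + apply/Forall2_val; rewrite size_reassign; split=> // k hk X XZ.
    by rewrite val_reassign // /g (negPf XZ).
  + apply: (IH sigma' _ rho' gamma _ mono' inj' _ _).2 h;
      rewrite ?size_reassign //.
      exact: pointwise_monotone_reassign.
    move=> k X hX; rewrite val_reassign // /g.
    have [->|XZ] := eqVneq X Z; first by rewrite sZ eqxx.
    rewrite sN // (negPf (sZ' _ hX XZ)) agree ?fv //.
    have [hk|hk] := ltnP k (size rho1); first by rewrite eq'.
    by rewrite /val !nth_default // -?es'.
- apply: IH => //; rewrite ?nextE.
  + exact: pointwise_monotone_drop.
  + exact: pointwise_monotone_drop.
  + by rewrite !size_drop es.
  + by move=> k X hX; rewrite !val_drop es; exact: agree.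
- have [sub1 sub2] := fpv_cat phi psi.
  have H1 k : truth (drop k rho) gamma (rename sigma phi) =
      truth (drop k rho1) gamma phi.
    apply: propext; apply: IH1; rewrite ?size_drop ?es //;
      do ?exact: pointwise_monotone_drop; first exact: sub_in2 inj.
    by move=> j X /sub1 hX; rewrite !val_drop; exact: agree.
  have H2 k : truth (drop k rho) gamma (rename sigma psi) =
      truth (drop k rho1) gamma psi.
    apply: propext; apply: IH2; rewrite ?size_drop ?es //;
      do ?exact: pointwise_monotone_drop; first exact: sub_in2 inj.
    by move=> j X /sub2 hX; rewrite !val_drop; exact: agree.
  by rewrite /= es; split=> -[k [hk hpsi hphi]]; exists k; split=> //;
    [rewrite -H2|move=> j hj; rewrite -H1; exact: hphi
    |rewrite H2|move=> j hj; rewrite H1; exact: hphi].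
Qed.

(** Since [X] is not free in [phi], replacing [OutP] by it is injective on the free variables, as
    [truth_rename] demands. The condition on [OutP] is restricted to formulas where it is free, so
    that [X] may be [OutP] itself. *)
Lemma truth_subst_out phi X rho rho1 gamma :
  pointwise_monotone rho -> pointwise_monotone rho1 ->
  X \notin fpv phi -> size rho = size rho1 ->
  (forall k, OutP \in fpv phi -> val rho k X = val rho1 k OutP) ->
  (forall k Y, Y \in fpv phi -> Y != OutP -> val rho k Y = val rho1 k Y) ->
  truth rho gamma (subst_out phi X) <-> truth rho1 gamma phi.
Proof.
move=> mono mono1 hX es hO hY; apply: truth_rename => //.
  move=> Y Z hY' hZ' /=; case: eqP => [->|_]; case: eqP => [->|_] // E.
    by rewrite E hZ' in hX.
  by rewrite -E hY' in hX.
move=> k Y hY' /=; case: eqP => [E|/eqP YO]; last exact: hY.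
by rewrite hO -E.
Qed.

(** * Reactive sequences as sequences of assignments *)

Lemma rseq_size (s : rseq C) : (0 < size s)%N.
Proof. by rewrite lt0n size_eq0; case: (rvalP s). Qed.

Lemma rseq_in_out (s : rseq C) k : (k < size s)%N ->
  (nth (\bot, \bot) s k).1 <= (nth (\bot, \bot) s k).2.
Proof. by have [_ _ /all_nthP h _ _] := rvalP s; exact: h. Qed.

Lemma rseq_out_in (s : rseq C) k : (k.+1 < size s)%N ->
  (nth (\bot, \bot) s k).2 <= (nth (\bot, \bot) s k.+1).1.
Proof.
by have [_ _ _ /(sortedP (\bot, \bot)) h _] := rvalP s; exact: h.
Qed.

Lemma rseq_last (s : rseq C) k : size s = k.+1 ->
  (nth (\bot, \bot) s k).1 = (nth (\bot, \bot) s k).2.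
Proof. by move=> sk; have [_ _ _ _] := rvalP s; rewrite -nth_last sk. Qed.

Lemma size_trace rho : size (trace rho) = size rho.
Proof. exact: size_map. Qed.

Lemma trace_drop m rho : trace (drop m rho) = drop m (trace rho).
Proof. exact: map_drop. Qed.

(** Turns a reactive sequence of a component into a sequence of assignments on which the formula of
    that component can be evaluated. Auxiliary variables stay as in [rho], so the change is confined
    to what the quantifiers of the hiding and parallel rules permit. *)
Definition overlay (s : seq (C * C)) rho :=
  reassign (fun X => if X is AuxP _ then None else Some X)
    [seq (fun X => if X is InP then u.1 else u.2) | u <- s] rho.

Lemma val_overlay s rho k : size s = size rho ->
  [/\ val (overlay s rho) k InP = (nth (\bot, \bot) s k).1,
      val (overlay s rho) k OutP = (nth (\bot, \bot) s k).2
    & forall n, val (overlay s rho) k (AuxP n) = val rho k (AuxP n)].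
Proof.
move=> es; have h X : val
    [seq (fun X : predvar => if X is InP then u.1 else u.2) | u <- s] k X =
    let u := nth (\bot, \bot) s k in if X is InP then u.1 else u.2.
  rewrite /val; have [hk|hk] := ltnP k (size s).
    by rewrite (nth_map (\bot, \bot)).
  by rewrite !nth_default ?size_map //; case: X.
by split=> [||n]; rewrite val_reassign ?size_map // h.
Qed.

Lemma trace_overlay s rho : size s = size rho -> trace (overlay s rho) = s.
Proof.
move=> es; apply: (@eq_from_nth _ (\bot, \bot)).
  by rewrite size_trace size_reassign es.
move=> k _; rewrite nth_trace; have [-> -> _] := val_overlay k es.
by rewrite -surjective_pairing.
Qed.

(** Inputs and outputs of [s] alternate in one increasing chain, which yields every condition on
    [InP] and [OutP]; the auxiliary variables inherit theirs from [rho]. *)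
Lemma monotonic_overlay (s : rseq C) rho : size s = size rho ->
  monotonic rho -> monotonic (overlay s rho).
Proof.
move=> es /monotonicP[h _ _]; apply/monotonicP; rewrite size_reassign -es.
split=> [k X|k|k] hk.
- have [i o a] := val_overlay k es; have [i' o' a'] := val_overlay k.+1 es.
  have io := rseq_in_out (ltnW hk); have io' := rseq_in_out hk.
  have oi := rseq_out_in hk.
  case: X => [||n]; rewrite ?i ?o ?a ?i' ?o' ?a'.
  + exact: le_trans io oi.
  + exact: le_trans oi io'.
  + by apply: h; rewrite -es.
- by have [-> -> _] := val_overlay k es; exact: rseq_in_out.
- have [_ -> _] := val_overlay k es; have [-> _ _] := val_overlay k.+1 es.
  exact: rseq_out_in.
Qed.

(** * Soundness of the rules, stated for the semantic operators on arbitrary sets *)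

Definition sat_on (S : set (rseq C)) phi :=
  forall rho, monotonic rho ->
    (exists2 s : rseq C, S s & rval s = trace rho) -> models rho phi.

Lemma sat_on_tell c : sat_on (tell_sem c) (tell_formula c).
Proof.
move=> rho mono [s [d [s' [stop_s' es]]] hs] gamma.
have tr k : let u := nth (\bot, \bot) ((d, d `|` c) :: rval s') k in
    val rho k InP = u.1 /\ val rho k OutP = u.2 by rewrite -es hs nth_trace.
have sz : size rho = (size s').+1 by rewrite -size_trace -hs es.
apply: truth_tell; first by have [-> ->] := tr 0%N.
  by rewrite sz ltnS; exact: rseq_size.
case=> // k; rewrite sz => /andP[_ hk].
by have [-> ->] := tr k.+1; rewrite /= (stop_s' _ (mem_nth _ hk)).
Qed.

Lemma sat_on_choice n (cs : 'I_n -> C) (S : 'I_n -> set (rseq C))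
    (phi : 'I_n -> formula C) :
  (forall i, sat_on (S i) (phi i)) ->
  sat_on (choice_sem cs S) (ask_formula cs phi).
Proof.
move=> hS rho mono [s hs es] gamma; rewrite truth_or.
case: hs => [[ds [dm [h [s' [hs hds hdm hs']]]]]|[ds [hs hds]]].
  left; apply/truth_bigor; exists h.
  (* The default [dm] of [nth] also covers position [size ds], where the guard becomes entailed. *)
  have tr k : (k <= size ds)%N -> val rho k InP = nth dm ds k /\
      val rho k OutP = nth dm ds k.
    move=> hk; have := nth_trace rho k; rewrite -es hs nth_cat size_map.
    rewrite size_rcons ltnS hk (nth_map dm) ?size_rcons ?ltnS // nth_rcons.
    case: ltngtP hk => // [hk _ [<- <-] //|->].
    by rewrite nth_default // => _ [<- <-].
  have sz : size rho = ((size ds).+1 + size s')%N.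
    by rewrite -size_trace -es hs size_cat size_map size_rcons.
  have s'0 := rseq_size s'.
  exists (size ds); split.
  - by rewrite sz addSn ltnS leq_addr.
  - have [tI tO] := tr _ (leqnn _); split.
      by rewrite /= firstE val_drop addn0 tI nth_default.
    split; first by rewrite truth_stut !val_drop addn0 tI tO.
    have -> : truth (drop (size ds) rho) gamma (FNext (phi h)) =
      truth (next (drop (size ds) rho)) gamma (phi h) by [].
    rewrite nextE size_drop drop_drop sz.
    (* As [s'] is nonempty, [next] really leaves the state of [dm] and reaches the start of [s']. *)
    have -> : (1 < (size ds).+1 + size s' - size ds)%N.
      by rewrite ltn_subRL addn1 addSn ltnS -{1}(addn0 (size ds)) ltn_add2l.
    apply: (hS h); first exact: monotonic_drop.
    exists s' => //; rewrite trace_drop -es hs add1n.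
    by rewrite drop_size_cat // size_map size_rcons.
  - move=> j hj; apply/truth_no_ask; rewrite !val_drop addn0.
    have [-> ->] := tr _ (ltnW hj); split=> // i.
    by apply: hds; exact: mem_nth.
right; rewrite truth_always => k hk; apply/truth_no_ask.
have sz : size ds = size rho by rewrite -size_trace -es hs size_map.
have := nth_trace rho k; rewrite -es hs (nth_map \bot) ?sz // !val_drop addn0.
by case=> <- <-; split=> // i; apply: hds; rewrite mem_nth ?sz.
Qed.

Lemma sat_on_now c (S1 S2 : set (rseq C)) phi psi :
  sat_on S1 phi -> sat_on S2 psi ->
  sat_on (now_sem c S1 S2) (now_formula c phi psi).
Proof.
move=> h1 h2 rho mono [s hs es] gamma; rewrite truth_or.
have e0 : first rho InP = (head (\bot, \bot) (rval s)).1.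
  by rewrite es -nth0 nth_trace firstE.
case: hs => -[hc hs]; [left|right]; rewrite /= e0; split=> //.
  by apply: h1 => //; exists s.
by apply: h2 => //; exists s.
Qed.

(** The sequence [s'] of the body, laid over [rho], is the witness: it agrees with [rho] up to
    [cyl x], and its connectedness gives [loc x]. Invariance of [s] gives [inv x] on [rho]
    itself. *)
Lemma sat_on_hide x (S : set (rseq C)) phi :
  sat_on S phi ->
  sat_on (hide_sem x S) (FAnd (FExCs x (FAnd phi (loc x))) (inv x)).
Proof.
move=> hS rho mono [s [s' [hs' ecyl [conn0 conn] invs]] es] gamma.
have ss : size s' = size rho.
  rewrite -size_trace -es; move/(congr1 size): ecyl.
  by rewrite !size_map.
have cyl_nth k : (k < size rho)%N ->
    cyl x (val rho k InP) = cyl x (nth (\bot, \bot) s' k).1 /\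
    cyl x (val rho k OutP) = cyl x (nth (\bot, \bot) s' k).2.
  move=> hk; move/(congr1 (fun t => nth (\bot, \bot) t k)): ecyl.
  rewrite !(nth_map (\bot, \bot)) ?ss ?es ?size_trace // nth_trace.
  by case=> -> ->.
split; last first.
  apply: truth_inv => k hk; have /= := invs (nth (\bot, \bot) s k).
  by rewrite es nth_trace => /= <- //; rewrite -nth_trace mem_nth ?size_trace.
exists (overlay s' rho); split.
- exact/monotonic_pointwise/monotonic_overlay.
- apply/Forall2_val; rewrite size_reassign; split=> // k hk X.
  have [i o a] := val_overlay k ss; have [ci co] := cyl_nth k hk.
  by case: X => [||n]; rewrite ?i ?o ?a.
split.
  apply: hS; first exact: monotonic_overlay.
  by exists s'; rewrite ?trace_overlay.
apply: truth_loc => [|k|k].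
- by have [-> _ _] := val_overlay 0 ss; rewrite nth0.
- rewrite size_reassign -ss => hk.
  have [-> _ _] := val_overlay k.+1 ss; have [_ -> _] := val_overlay k ss.
  exact/eqP/(sortedP _ conn).
- rewrite size_reassign -ss => hk; have [-> -> _] := val_overlay k ss.
  exact: rseq_last.
Qed.

(** The shared final pair, and the default past the end, fit the same equations because join is
    idempotent. *)
Lemma par_seqP (s1 s2 s : seq (C * C)) : par_seq s1 s2 s ->
  [/\ size s1 = size s, size s2 = size s
    & forall k, [/\ (nth (\bot, \bot) s1 k).1 = (nth (\bot, \bot) s k).1,
      (nth (\bot, \bot) s2 k).1 = (nth (\bot, \bot) s k).1
    & (nth (\bot, \bot) s k).2 =
      (nth (\bot, \bot) s1 k).2 `|` (nth (\bot, \bot) s2 k).2]].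
Proof.
case=> t [d [-> -> ->]]; split; rewrite ?size_rcons ?size_map // => k.
rewrite !nth_rcons !size_map; case: ltngtP => hk.
- by rewrite !(nth_map (\bot, (\bot, \bot))).
- by rewrite joinxx.
- by rewrite joinxx.
Qed.

(** The outputs of the two components serve as values of [X] and [Y]. Both components share the
    inputs of [rho], so [rho1] and [rho2] differ from it at [OutP] only, and [truth_subst_out]
    transfers [phi] and [psi]. *)
Lemma sat_on_par (S1 S2 : set (rseq C)) phi psi X Y :
  X != Y -> X \notin fpv phi ++ fpv psi -> Y \notin fpv phi ++ fpv psi ->
  sat_on S1 phi -> sat_on S2 psi ->
  sat_on (par_sem S1 S2)
    (FExP X (FExP Y
       (FAnd (subst_out phi X) (FAnd (subst_out psi Y) (par X Y))))).
Proof.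
rewrite !mem_cat !negb_or => XY /andP[Xphi Xpsi] /andP[Yphi Ypsi] h1 h2 rho.
move=> mono [s [s1 [s2 [hs1 hs2 /par_seqP[sz1 sz2 hpar]]]] es] gamma.
rewrite es size_trace in sz1 sz2 hpar.
pose rho1 := overlay s1 rho; pose rho2 := overlay s2 rho.
have mono1 : monotonic rho1 by exact: monotonic_overlay.
have mono2 : monotonic rho2 by exact: monotonic_overlay.
have t1 : truth rho1 gamma phi.
  by apply: h1 => //; exists s1; rewrite ?trace_overlay.
have t2 : truth rho2 gamma psi.
  by apply: h2 => //; exists s2; rewrite ?trace_overlay.
have szr1 : size rho1 = size rho by exact: size_reassign.
have szr2 : size rho2 = size rho by exact: size_reassign.
have v1 k Z : Z != OutP -> val rho1 k Z = val rho k Z.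
  have [i _ a] := val_overlay k sz1; case: (hpar k) => e1 _ _.
  by case: Z => [_||n _] //; rewrite /rho1 ?i ?a // e1 nth_trace.
have v2 k Z : Z != OutP -> val rho2 k Z = val rho k Z.
  have [i _ a] := val_overlay k sz2; case: (hpar k) => _ e2 _.
  by case: Z => [_||n _] //; rewrite /rho2 ?i ?a // e2 nth_trace.
have vO k : val rho k OutP = val rho1 k OutP `|` val rho2 k OutP.
  have [_ -> _] := val_overlay k sz1; have [_ -> _] := val_overlay k sz2.
  by case: (hpar k) => _ _ <-; rewrite nth_trace.
(* When [X] or [Y] is [OutP] itself, its old value is kept: the corresponding
   formula does not mention it. *)
pose a := if X == OutP then rho else rho1.
pose b := if Y == OutP then rho else rho2.
have sza : size a = size rho by rewrite /a; case: ifP.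
pose rhoX := reassign (fun Z => if Z == X then Some OutP else None) a rho.
have szX : size rhoX = size rho by exact: size_reassign.
have szb : size b = size rhoX by rewrite /b szX; case: ifP.
pose rhoXY := reassign (fun Z => if Z == Y then Some OutP else None) b rhoX.
have szXY : size rhoXY = size rho by rewrite size_reassign.
have monoX : pointwise_monotone rhoX.
  apply: pointwise_monotone_reassign => //; last exact: monotonic_pointwise.
  by rewrite /a; case: ifP => _; exact: monotonic_pointwise.
have monoXY : pointwise_monotone rhoXY.
  apply: pointwise_monotone_reassign => //.
  by rewrite /b; case: ifP => _; exact: monotonic_pointwise.
have vX k Z : val rhoX k Z = if Z == X then val a k OutP else val rho k Z.
  by rewrite val_reassign //; case: (Z == X).
have vXY k Z : val rhoXY k Z = if Z == Y then val b k OutP else val rhoX k Z.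
  by rewrite val_reassign //; case: (Z == Y).
exists rhoX; split=> //.
  apply/Forall2_val; split=> // k hk Z /negPf ZX.
  by rewrite vX ZX.
exists rhoXY; split=> //.
  apply/Forall2_val; split; first by rewrite szX szXY.
  by move=> k hk Z /negPf ZY; rewrite vXY ZY.
have neq Z W (r : seq predvar) : Z \in r -> W \notin r -> (Z == W) = false.
  by move=> hZ; apply: contraNF => /eqP <-.
split; last split.
- apply: (truth_subst_out gamma monoXY _ Xphi _ _ _).2 t1.
  + exact: monotonic_pointwise.
  + by rewrite szXY.
  + move=> k hO; rewrite vXY vX (negPf XY) eqxx /a eq_sym.
    by rewrite (neq _ _ _ hO Xphi).
  + move=> k Z hZ ZO; rewrite vXY vX (neq _ _ _ hZ Xphi) (neq _ _ _ hZ Yphi).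
    by rewrite v1.
- apply: (truth_subst_out gamma monoXY _ Ypsi _ _ _).2 t2.
  + exact: monotonic_pointwise.
  + by rewrite szXY.
  + by move=> k hO; rewrite vXY eqxx /b eq_sym (neq _ _ _ hO Ypsi).
  + move=> k Z hZ ZO; rewrite vXY vX (neq _ _ _ hZ Xpsi) (neq _ _ _ hZ Ypsi).
    by rewrite v2.
rewrite truth_par szXY => k hk; rewrite !vXY !vX eqxx (negPf XY) eqxx /a /b.
(* If one of the variables is [OutP], its value is the whole output, which absorbs the output of the
   other component. *)
rewrite ![OutP == _]eq_sym; case: eqP => _; case: eqP => _ //.
- by rewrite joinxx.
- by rewrite vO joinA joinxx.
- by rewrite vO -joinA joinxx.
Qed.

(** * Induction on derivations *)

Lemma soundness (Gamma : set (assertion C)) D A phi :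
  derivable Gamma D A phi -> forall e,
  (forall a, Gamma a ->
    valid_sat e (sat_decls a) (sat_agent a) (sat_formula a)) ->
  valid_sat e D A phi.
Proof.
elim=> {Gamma D A phi}
  [Gamma D A phi h|Gamma D c|Gamma D n cs As phi _ IH
  |Gamma D c A B phi psi _ IHA _ IHB|Gamma D x A phi _ IH
  |Gamma D A B phi psi X Y XY hX hY _ IHA _ IHB|Gamma D p x A phi hA _ IH
  |Gamma D A phi psi _ IH himp] e hGamma.
- exact: hGamma h.
- by rewrite /valid_sat den_tell; exact: sat_on_tell.
- rewrite /valid_sat den_ask; apply: sat_on_choice => i; exact: IH.
- by rewrite /valid_sat den_now; apply: sat_on_now; [exact: IHA|exact: IHB].
- by rewrite /valid_sat den_hide; apply: sat_on_hide; exact: IH.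
- rewrite /valid_sat den_par; apply: sat_on_par => //; [exact: IHA|exact: IHB].
- rewrite /valid_sat (den_call _ hA) => rho mono [s hs es].
  pose f := [set s : rseq C |
    forall rho, monotonic rho -> rval s = trace rho -> models rho phi].
  suff hf : den D.[~ p]%fmap A [eta e with p |-> f] `<=` f.
    by apply: (hs f hf).
  move=> {rho mono s hs es} s hs rho mono es.
  apply: (IH [eta e with p |-> f] _ rho mono); last by exists s.
  move=> [D' A' psi] /= [[ha hfree]|[-> -> ->]].
    (* A retained assumption does not have [p] free, so it means the same under [e] and under the
       update. *)
    rewrite /valid_sat (@den_eq_free _ _ _ e) => [|q hq].
      exact: hGamma ha.
    by rewrite /=; case: eqP hq => // ->.
  (* For the discharged assumption [p] is undeclared, so the call denotes [f], whose members satisfy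
     [phi] by construction. *)
  move=> rho' mono' [s']; rewrite den_free ?mem_remf1 ?eqxx //=.
  by rewrite eqxx; exact.
- move=> rho mono [s hs es] gamma.
  (* [valid] ranges over nonempty sequences; a reactive sequence has at least one pair. *)
  have rho0 : rho != [::].
    by rewrite -size_eq0 -size_trace -es -lt0n; exact: rseq_size.
  have := himp rho rho0 mono gamma; rewrite truth_imp; apply.
  by apply: (IH e hGamma rho mono); exists s.
Qed.

End Soundness.

Theorem theorem2 (disp : Order.disp_t) (C : cylindricType disp)
    (n : nat) (D_ : 'I_n -> decls C) (A_ : 'I_n -> agent C)
    (phi_ : 'I_n -> formula C)
    (D : decls C) (A : agent C) (phi : formula C) (e : env C)
    (hprocess_ : forall i, process (D_ i) (A_ i))
    (hprocess : process D A)
    (hderiv : derivable (range (fun i => Sat (D_ i) (A_ i) (phi_ i))) D A phi)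
    (hsat_ : forall i, valid_sat e (D_ i) (A_ i) (phi_ i)) :
  valid_sat e D A phi.
Proof. by apply: (soundness hderiv) => _ [i _ <-]; exact: hsat_. Qed.
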